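(* Let $\mathcal{E}$ be a complex separable Hilbert space, let $k\ge1$, and let $J_k$ be the truncated shift of index $k$ on $\mathcal{E}\otimes\mathbb{C}^k$. The only hyperinvariant subspaces of $J_k$ are $\mathcal{N}(J_k^n)$, $n=0,1,\ldots,k$; that is, a closed subspace of $\mathcal{E}\otimes\mathbb{C}^k$ is hyperinvariant for $J_k$ if and only if it equals $\mathcal{N}(J_k^n)$ for some $n\in\{0,1,\ldots,k\}$.
   Context: $\mathcal{N}(\cdot)$ denotes kernel. The truncated shift of index $k$ on $\mathcal{E}\otimes\mathbb{C}^k$ (the direct sum of $k$ copies of $\mathcal{E}$) is $J_1=0$ and, for $k\ge2$, $J_k(x_1,\ldots,x_k)=(0,x_1,\ldots,x_{k-1})$; $J_k^0=I$. A closed subspace is hyperinvariant for $T$ if it is invariant under every bounded operator commuting with $T$. *)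

(* Defs.v *)
From HB Require Import structures.
From mathcomp Require Import all_boot all_order all_algebra.
From mathcomp Require Import sesquilinear spectral complex.
From mathcomp Require Import all_classical all_reals.
From mathcomp Require Import topology normedtype.

Set Implicit Arguments.
Unset Strict Implicit.
Unset Printing Implicit Defensive.

Import Order.TTheory GRing.Theory Num.Theory Num.Def.
Import numFieldNormedType.Exports.

Local Open Scope classical_set_scope.
Local Open Scope ring_scope.

HB.mixin Record CompleteNormedModule_isHilbert (C : numClosedFieldType) E
    & CompleteNormedModule C E := {
  hdot : {dot E for (@conjC C)};
  hdot_norm : forall x : E, hdot x x = `|x| ^+ 2
}.

#[short(type="hilbertType")]
HB.structure Definition Hilbert (C : numClosedFieldType) :=
  {E of CompleteNormedModule_isHilbert C E & CompleteNormedModule C E}.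

(* The Hilbert space direct sum of k copies of E. It is a type alias so that
   it carries the l2 norm rather than any norm attached to {ffun 'I_k -> E}. *)
Definition hsum (k : nat) (E : Type) : Type := {ffun 'I_k -> E}.

HB.instance Definition _ (C : numClosedFieldType) (E : lmodType C) k :=
  GRing.Lmodule.copy (hsum k E) {ffun 'I_k -> E}.

Section HilbertSum.
Variables (C : numClosedFieldType) (k : nat).

Section Normed.
Variable E : normedModType C.
Implicit Types x y : hsum k E.

Definition hsum_norm x : C := sqrtC (\sum_(i < k) `|x i| ^+ 2).

Let nrow x : 'rV[C]_k := \row_i `|x i|.

Let dot_nrow (u : 'rV[C]_k) : dotmx u u = \sum_i `|u 0 i| ^+ 2.
Proof.
by rewrite dotmxE !mxE; apply: eq_bigr => i _; rewrite !mxE -normCK.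
Qed.

Let hsum_normE x : hsum_norm x = sqrtC (dotmx (nrow x) (nrow x)).
Proof.
rewrite dot_nrow; congr sqrtC; apply: eq_bigr => i _.
by rewrite !mxE normr_id.
Qed.

Let sum_ge0 x : 0 <= \sum_(i < k) `|x i| ^+ 2.
Proof. by apply: sumr_ge0 => i _; rewrite exprn_ge0. Qed.

Lemma ler_hsum_normD x y : hsum_norm (x + y) <= hsum_norm x + hsum_norm y.
Proof.
pose u := nrow x; pose v := nrow y.
have tri : sqrtC (dotmx (u + v) (u + v)) <=
           sqrtC (dotmx u u) + sqrtC (dotmx v v).
  exact: (triangle_lerif (@dotmx C k) u v).1.
rewrite (hsum_normE x) (hsum_normE y); apply: le_trans tri.
rewrite dot_nrow /hsum_norm ler_sqrtC ?nnegrE//; last first.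
  by apply: sumr_ge0 => i _; rewrite exprn_ge0.
apply: ler_sum => i _; rewrite !mxE !ffunE.
rewrite [X in _ <= X ^+ 2]ger0_norm ?addr_ge0//.
by rewrite lerXn2r ?nnegrE ?addr_ge0// ler_normD.
Qed.

Lemma hsum_normZ (a : C) x : hsum_norm (a *: x) = `|a| * hsum_norm x.
Proof.
rewrite /hsum_norm.
under eq_bigr do rewrite ffunE normrZ exprMn.
by rewrite -mulr_sumr rootCMl ?exprn_ge0// exprCK.
Qed.

Lemma hsum_norm0_eq0 x : hsum_norm x = 0 -> x = 0.
Proof.
move/eqP; rewrite sqrtC_eq0 psumr_eq0 => [/allP x0|i _]; last first.
  by rewrite exprn_ge0.
apply/ffunP => i; rewrite ffunE; apply/eqP.
by have := x0 i (mem_index_enum i); rewrite /= expf_eq0/= normr_eq0.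
Qed.

HB.instance Definition _ := Lmodule_isNormed.Build C (hsum k E)
  ler_hsum_normD hsum_normZ hsum_norm0_eq0.

Lemma hsum_normrE x : `|x| = sqrtC (\sum_(i < k) `|x i| ^+ 2).
Proof. by []. Qed.

Lemma ler_hsum_coord x i : `|x i| <= `|x|.
Proof.
rewrite -(exprCK (ltn0Sn 1) (normr_ge0 (x i))) hsum_normrE.
rewrite ler_sqrtC ?nnegrE ?exprn_ge0// (bigD1 i)//= lerDl.
by apply: sumr_ge0 => j _; rewrite exprn_ge0.
Qed.

Lemma hsum_normr_le x (e : C) : 0 <= e -> (forall i, `|x i| <= e) ->
  `|x| <= e * k%:R.
Proof.
move=> e0 xe; rewrite hsum_normrE.
rewrite -(exprCK (ltn0Sn 1) (_ : 0 <= e * k%:R)) ?mulr_ge0//.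
rewrite ler_sqrtC ?nnegrE ?exprn_ge0 ?mulr_ge0//.
apply: (@le_trans _ _ (\sum_(i < k) e ^+ 2)).
  by apply: ler_sum => i _; rewrite lerXn2r ?nnegrE.
rewrite sumr_const card_ord exprMn -[e ^+ 2 *+ k]mulr_natr ler_wpM2l ?exprn_ge0//.
by rewrite -natrX ler_nat; case: k => // n; rewrite leq_pmulr.
Qed.

End Normed.

Lemma hsum_complete (E : completeNormedModType C)
    (F : set_system (hsum k E)) : ProperFilter F -> cauchy F -> cvg F.
Proof.
move=> FF /cauchy_ballP Fc.
have cvi i : cvg ((fun x : hsum k E => x i) @ F).
  apply: cauchy_cvg; apply/cauchy_ballP => e e0.
  have [[A B] [/= FA FB] AB] := Fc e e0.
  exists ([set x i | x in A], [set y i | y in B]) => /=.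
    by split; [apply: filterS FA|apply: filterS FB] => x Px; exists x.
  move=> [_ _] /= [[x Ax <-] [y By <-]].
  have := AB (x, y) (conj Ax By); rewrite -!ball_normE/=.
  apply: le_lt_trans; have := ler_hsum_coord (x - y) i.
  by rewrite !ffunE.
apply/cvg_ex.
pose l : hsum k E := [ffun i => lim ((fun x : hsum k E => x i) @ F)].
exists l; apply/cvgrPdist_le => e e0.
have d0 : 0 < e / k.+1%:R by rewrite divr_gt0.
have H : F [set x : hsum k E | forall i, `|l i - x i| <= e / k.+1%:R].
  apply: filter_forall => i; rewrite ffunE.
  by move/cvgrPdist_le: (cvi i) => /(_ _ d0).
apply: filterS H => x H.
apply: le_trans (hsum_normr_le (ltW d0) _) _.
  by move=> i; have := H i; rewrite !ffunE.
by rewrite mulrAC ler_pdivrMr// ler_wpM2l ?(ltW e0)// ler_nat.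
Qed.

HB.instance Definition _ (E : completeNormedModType C) :=
  Uniform_isComplete.Build (hsum k E) (@hsum_complete E).

Section Dot.
Variable E : hilbertType C.

Definition hsum_dot (x y : hsum k E) : C := \sum_(i < k) hdot (x i) (y i).

Let hsum_dot_bilinear :
  bilinear_for *%R (conjC \; *%R) hsum_dot.
Proof.
split=> [y a x x'|x a y y'] /=; rewrite mulr_sumr -big_split/=.
  by apply: eq_bigr => i _; rewrite !ffunE linearDl/= linearZl_LR.
by apply: eq_bigr => i _; rewrite !ffunE linearDr/= linearZr_LR.
Qed.

HB.instance Definition _ :=
  bilinear_isBilinear.Build C (hsum k E) (hsum k E) C _ _
    hsum_dot hsum_dot_bilinear.

Let hsum_dotC x y :
  hsum_dot x y = (-1) ^+ false * (hsum_dot y x)^*.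
Proof.
rewrite mul1r rmorph_sum; apply: eq_bigr => i _.
by rewrite hermC mul1r.
Qed.

HB.instance Definition _ := isHermitianSesquilinear.Build C (hsum k E) false
  conjC hsum_dot hsum_dotC.

Let hsum_dot_norm (x : hsum k E) : hsum_dot x x = `|x| ^+ 2.
Proof.
by rewrite hsum_normrE sqrtCK; apply: eq_bigr => i _; rewrite hdot_norm.
Qed.

Let hsum_dot_gt0 (x : hsum k E) : x != 0 -> 0 < hsum_dot x x.
Proof. by move=> x0; rewrite hsum_dot_norm exprn_gt0// normr_gt0. Qed.

HB.instance Definition _ := isDotProduct.Build C (hsum k E) hsum_dot
  hsum_dot_gt0.

HB.instance Definition _ := CompleteNormedModule_isHilbert.Build C (hsum k E)
  hsum_dot_norm.

End Dot.
End HilbertSum.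

Section TruncatedShift.
Variables (C : numClosedFieldType) (E : lmodType C) (k : nat).

(* [ord_pred i] is i - 1 for 0 < i; its cyclic value at i = 0 is never used. *)
Definition trunc_shift (x : hsum k E) : hsum k E :=
  [ffun i : 'I_k => if val i == 0%N then 0 else x (ord_pred i)].

Let trunc_shift_linear : linear trunc_shift.
Proof.
move=> a x y; apply/ffunP => i; rewrite !ffunE.
by case: ifP => _; rewrite ?scaler0 ?addr0.
Qed.

HB.instance Definition _ :=
  GRing.isLinear.Build C (hsum k E) (hsum k E) _ trunc_shift
    trunc_shift_linear.

End TruncatedShift.

Definition separable_space (T : topologicalType) : Prop :=
  exists2 D : set T, countable D & dense D.

Section Hyperinvariant.
Variables (C : numFieldType) (V : normedModType C).

Definition bounded_op (A : {linear V -> V}) : Prop :=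
  exists c : C, forall x, `|A x| <= c * `|x|.

Definition closed_subspace (M : set V) : Prop :=
  [/\ M 0, forall (a : C) (x y : V), M x -> M y -> M (a *: x + y) & closed M].

Definition hyperinvariant (T : {linear V -> V}) (M : set V) : Prop :=
  closed_subspace M /\
  forall A : {linear V -> V}, bounded_op A ->
    (forall x, A (T x) = T (A x)) -> A @` M `<=` M.

End Hyperinvariant.

Definition kernel (V W : nmodType) (f : V -> W) : set V := [set x | f x = 0].

(* Main.v *)
Require Import Defs.
From HB Require Import structures.
From mathcomp Require Import all_boot all_order all_algebra complex.
From mathcomp Require Import all_classical all_reals topology normedtype.
From mathcomp Require Import sesquilinear.
Import Order.TTheory GRing.Theory Num.Theory.
Import numFieldNormedType.Exports.

Set Implicit Arguments.
Unset Strict Implicit.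
Unset Printing Implicit Defensive.

Local Open Scope classical_set_scope.
Local Open Scope ring_scope.
Local Open Scope complex_scope.

(** The truncated shift [J] moves every coordinate one step up and discards
    the last one, so the kernel of its [n]-th power consists of the vectors
    whose first [k - n] coordinates vanish.  These spaces are closed, and the
    kernel of a power of [J] is stable under everything that commutes with
    [J]; this settles one implication.

    For the other one, let [M] be hyperinvariant and let [m <= k] be the
    largest index such that every vector of [M] vanishes below [m].  If
    [m < k], some [x] in [M] has [v := x m] nonzero, and two kinds of
    operators commuting with [J] produce everything else from [x]: the powers
    of [J], which move the leading coefficient [v] to any position [j >= m],
    and the operators [B] acting on all coordinates simultaneously, where [B]
    has rank one on [E] and can send [v] to any prescribed vector
    ([diag_rank_one]; its boundedness is the Cauchy-Schwarz inequality).
    Hence any vector that vanishes below [j] agrees at [j] with an element of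
    [M] that also vanishes below [j] ([leading_term_in]).  Subtracting leading
    terms one after the other shows that all vectors vanishing below [m]
    belong to [M] ([vanishing_below_sub]). *)

Section CauchySchwarz.
Variables (C : numClosedFieldType) (E : hilbertType C).

(** Expand the square norm of [w = |v|^2 u - <u, v> v], which is orthogonal
    to [v]. *)
Lemma hdot_le_norm (u v : E) : `|hdot u v| <= `|u| * `|v|.
Proof.
have [->|v0] := eqVneq v 0; first by rewrite linear0r !normr0 mulr0.
have nv0 : 0 < `|v| ^+ 2 by rewrite exprn_gt0// normr_gt0.
pose w := `|v| ^+ 2 *: u - hdot u v *: v.
have wv : hdot w v = 0.
  by rewrite linearBl/= !linearZl_LR/= !hdot_norm mulrC subrr.
have ww : hdot w w = `|v| ^+ 2 * (`|v| ^+ 2 * `|u| ^+ 2 - `|hdot u v| ^+ 2).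
  rewrite {2}/w linearBr/= !linearZr_LR/= wv mulr0 subr0.
  rewrite (CrealP _) ?realX ?normr_real//; congr (_ * _).
  rewrite linearBl/= !linearZl_LR/= hdot_norm; congr (_ - _).
  by rewrite (hermC hdot v u)/= expr0 mul1r -normCK.
have := exprn_ge0 2 (normr_ge0 w).
rewrite -hdot_norm ww pmulr_rge0// subr_ge0 mulrC -exprMn.
by rewrite ler_pXn2r// nnegrE ?mulr_ge0.
Qed.

End CauchySchwarz.

Section ShiftKernels.
Variables (C : numClosedFieldType) (k : nat).

Definition vanishing_below (E : lmodType C) (m : nat) : set (hsum k E) :=
  [set x | forall i : 'I_k, (i < m)%N -> x i = 0].

Lemma iter_trunc_shift_low (E : lmodType C) n (x : hsum k E) (i : 'I_k) :
  (i < n)%N -> iter n (@trunc_shift C E k) x i = 0.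
Proof.
elim: n i => // n IH i; rewrite iterS ffunE /=; case: eqP => // /eqP i0 in_.
apply: IH => /=; rewrite -subn1 addnC -addnBA ?lt0n// modnDl modn_small.
  by rewrite -ltnS subn1 prednK ?lt0n.
by rewrite (leq_ltn_trans (leq_subr _ _)).
Qed.

Lemma iter_trunc_shift_high (E : lmodType C) n (x : hsum k E) (i j : 'I_k) :
  i = (j + n)%N :> nat -> iter n (@trunc_shift C E k) x i = x j.
Proof.
elim: n i => [|n IH] i ij.
  by congr (x _); apply/val_inj; rewrite /= ij addn0.
rewrite iterS ffunE /= ij addnS/=; apply: IH => /=.
rewrite ij addnS addSn/= modnDr modn_small//.
by rewrite (leq_trans _ (ltn_ord i))// ij addnS.
Qed.

Lemma kernel_iter_trunc_shift (E : lmodType C) n : (n <= k)%N ->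
  kernel (iter n (@trunc_shift C E k)) = @vanishing_below E (k - n).
Proof.
move=> nk; apply/seteqP; split => x /=.
  move=> Tx i ik; have ink : (i + n < k)%N by rewrite addnC -ltn_subRL.
  rewrite -(@iter_trunc_shift_high _ n x (Ordinal ink) i erefl).
  by have /ffunP/(_ (Ordinal ink)) := Tx; rewrite ffunE.
move=> x0; apply/ffunP => i; rewrite [RHS]ffunE.
have [lin|nli] := ltnP i n; first exact: iter_trunc_shift_low.
have ink : (i - n < k)%N by rewrite (leq_ltn_trans (leq_subr _ _)).
rewrite (@iter_trunc_shift_high _ n x i (Ordinal ink)) /= ?subnK//.
by apply: x0 => /=; rewrite ltn_sub2r// (leq_ltn_trans nli).
Qed.

Lemma hsum_coord_continuous (E : normedModType C) (i : 'I_k) :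
  continuous (fun x : hsum k E => x i).
Proof.
move=> x; apply/(@cvgrPdist_lt _ _ _ _ (nbhs_filter x)) => e e0.
apply/nbhs_ballP; exists e => //= y.
rewrite -ball_normE /=; apply: le_lt_trans.
by have := ler_hsum_coord (x - y) i; rewrite !ffunE.
Qed.

Lemma vanishing_below_closed_subspace (E : normedModType C) m :
  closed_subspace (@vanishing_below E m).
Proof.
split=> [i _|a x y x0 y0 i im|]; first by rewrite ffunE.
  by rewrite !ffunE x0// y0// scaler0 addr0.
rewrite (_ : vanishing_below _ = \bigcap_(i in [set i : 'I_k | (i < m)%N])
    ((fun x : hsum k E => x i) @^-1` [set 0])); last first.
  by apply/seteqP; split => x /= x0 i; apply: x0.
apply: closed_bigI => i _; apply: preimage_closed => [x _|].
  exact: hsum_coord_continuous.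
apply: accessible_closed_set1; apply: hausdorff_accessible.
exact: norm_hausdorff.
Qed.

(** An operator commuting with [J] commutes with its powers, hence preserves
    their kernels. *)
Lemma kernel_iter_hyperinvariant (E : normedModType C) n : (n <= k)%N ->
  hyperinvariant (@trunc_shift C E k) (kernel (iter n (@trunc_shift C E k))).
Proof.
move=> nk; split.
  by rewrite kernel_iter_trunc_shift//; exact: vanishing_below_closed_subspace.
move=> A _ AT _ /= [x Tx <-]; rewrite /kernel /=.
have <- : A (iter n (@trunc_shift C E k) x) = iter n (@trunc_shift C E k) (A x).
  by elim: n {nk Tx} => // n IH; rewrite !iterS AT IH.
by rewrite Tx raddf0.
Qed.

End ShiftKernels.

Section Commutant.
Variables (C : numClosedFieldType) (E : hilbertType C) (k : nat).
Notation J := (@trunc_shift C E k).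

Lemma trunc_shift_bounded : bounded_op J.
Proof.
exists k%:R => x; rewrite mulrC; apply: hsum_normr_le => // i.
by rewrite ffunE; case: ifP => _; rewrite ?normr0 ?ler_hsum_coord.
Qed.

Definition diag_rank_one (v e : E) (x : hsum k E) : hsum k E :=
  [ffun i => hdot (x i) v *: e].

Section Linear.
Variables v e : E.

Let diag_rank_one_linear : linear (diag_rank_one v e).
Proof.
move=> a x y; apply/ffunP => i.
by rewrite !ffunE linearDl/= linearZl_LR/= scalerDl scalerA.
Qed.

HB.instance Definition _ :=
  GRing.isLinear.Build C (hsum k E) (hsum k E) _ (diag_rank_one v e)
    diag_rank_one_linear.

End Linear.

Lemma diag_rank_one_bounded v e : bounded_op (diag_rank_one v e).
Proof.
exists (`|v| * `|e| * k%:R) => x; rewrite mulrAC.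
apply: hsum_normr_le => [|i]; first by rewrite !mulr_ge0.
rewrite ffunE normrZ mulrAC ler_wpM2r// mulrC.
by rewrite (le_trans (hdot_le_norm _ _))// ler_wpM2r// ler_hsum_coord.
Qed.

Lemma diag_rank_one_comm v e x :
  diag_rank_one v e (J x) = J (diag_rank_one v e x).
Proof.
apply/ffunP => i; rewrite !ffunE; case: ifP => // _.
by rewrite linear0l scale0r.
Qed.

End Commutant.

Section Hyperinvariant.
Variables (C : numClosedFieldType) (E : hilbertType C) (k : nat).
Notation J := (@trunc_shift C E k).
Variable M : set (hsum k E).
Hypothesis hypM : hyperinvariant J M.

Lemma hyperinvariant_iter n x : M x -> M (iter n J x).
Proof.
move=> Mx; elim: n => // n IH; rewrite iterS.
by apply: (hypM.2 J (@trunc_shift_bounded _ _ _)) => //; exists (iter n J x).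
Qed.

(** Move the leading coefficient [x m] to position [j] by a power of the
    shift, then send it to [e] by the rank-one operator
    [y |-> <y, x m> e / |x m|^2] on [E]. *)
Lemma leading_term_in (x : hsum k E) (m j : 'I_k) (e : E) :
    M x -> vanishing_below m x -> x m != 0 -> (m <= j)%N ->
  exists z, [/\ M z, vanishing_below j z & z j = e].
Proof.
move=> Mx xm xm0 mj; pose A := diag_rank_one (x m) ((`|x m| ^+ 2)^-1 *: e).
have jm : j = (m + (j - m))%N :> nat by rewrite subnKC.
exists (A k (iter (j - m) J x)); split.
- apply: (hypM.2 _ (@diag_rank_one_bounded _ _ _ _ _)).
    exact: diag_rank_one_comm.
  by exists (iter (j - m) J x) => //; apply: hyperinvariant_iter.
- move=> i ij; rewrite ffunE.
  suff -> : iter (j - m) J x i = 0 by rewrite linear0l scale0r.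
  have [?|jmi] := ltnP i (j - m)%N; first exact: iter_trunc_shift_low.
  have ik : (i - (j - m) < k)%N by rewrite (leq_ltn_trans (leq_subr _ _)).
  rewrite (@iter_trunc_shift_high _ _ _ _ x i (Ordinal ik)) /= ?subnK//.
  by apply: xm => /=; rewrite ltn_subLR// addnC -jm.
- rewrite ffunE (iter_trunc_shift_high _ jm) hdot_norm scalerA mulfV ?scale1r//.
  by rewrite expf_neq0// normr_eq0.
Qed.

(** Downward induction on [j]: a vector vanishing below [j] is the sum of an
    element of [M] with the same leading term and a vector vanishing below
    [j + 1]. *)
Lemma vanishing_below_sub (x : hsum k E) (m : 'I_k) :
    M x -> vanishing_below m x -> x m != 0 ->
  @vanishing_below C k E m `<=` M.
Proof.
move=> Mx xm xm0; have [[M0 MD _] _] := hypM.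
suff H d j : (j + d)%N = k -> (m <= j)%N -> @vanishing_below C k E j `<=` M.
  by apply: (H (k - m)%N m) => //; rewrite subnKC// ltnW.
elim: d j => [|d IH] j jd mj y yj.
  rewrite (_ : y = 0)//; apply/ffunP => i; rewrite ffunE; apply: yj.
  by rewrite -(addn0 j) jd.
have jk : (j < k)%N by rewrite -jd addnS ltnS leq_addr.
have [z [Mz zj zy]] :=
  @leading_term_in x m (Ordinal jk) (y (Ordinal jk)) Mx xm xm0 mj.
have {IH}Myz : M (y - z).
  apply: (IH j.+1) => [||i]; [by rewrite addSnnS|exact: leqW|].
  rewrite ltnS leq_eqVlt => /predU1P[ij|ij]; rewrite !ffunE.
    have -> : i = Ordinal jk by apply: val_inj.
    by rewrite zy subrr.
  by rewrite yj// zj// subrr.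
by have := MD 1 _ _ Mz Myz; rewrite scale1r addrC subrK.
Qed.

(** The [m] found here is the largest index below which all of [M] vanishes;
    by maximality some vector of [M] is nonzero at [m], unless [m = k]. *)
Lemma hyperinvariant_vanishing_below :
  exists2 m, (m <= k)%N & M = @vanishing_below C k E m.
Proof.
pose P m := (m <= k)%N && `[< M `<=` @vanishing_below C k E m >].
have exP : exists m, P m by exists 0%N; apply/andP; split=> //; apply/asboolP.
have ubP m : P m -> (m <= k)%N by case/andP.
case: (ex_maxnP exP ubP) => m /andP[mk /asboolP Mm] maxm.
exists m => //; apply/seteqP; split => //.
move: mk; rewrite leq_eqVlt => /predU1P[mk|mk].
  have [[M0 _ _] _] := hypM; move=> y ym; rewrite (_ : y = 0)//.
  by apply/ffunP => i; rewrite ffunE; apply: ym; rewrite mk.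
have : ~ (M `<=` @vanishing_below C k E m.+1).
  by move=> /asboolP Mm1; have := maxm m.+1; rewrite /P mk Mm1 ltnn => /(_ isT).
move=> /existsNP[x /not_implyP[Mx /existsNP[i /not_implyP[im /eqP xi]]]].
have mi : i = m :> nat.
  apply/eqP; rewrite eqn_leq -ltnS im leqNgt; apply/negP => /(Mm _ Mx) xi0.
  by rewrite xi0 eqxx in xi.
by rewrite -mi; apply: (vanishing_below_sub Mx) => //; rewrite mi; apply: Mm.
Qed.

End Hyperinvariant.

Theorem lemma5p4 (R : realType) (E : hilbertType R[i])
    (sepE : separable_space E) (k : nat) (hk : (1 <= k)%N)
    (M : set (hsum k E)) :
  hyperinvariant (@trunc_shift _ E k) M <->
  exists2 n : nat, (n <= k)%N & M = kernel (iter n (@trunc_shift _ E k)).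
Proof.
split=> [hypM|[n nk ->]]; last exact: kernel_iter_hyperinvariant.
have [m mk ->] := hyperinvariant_vanishing_below hypM.
exists (k - m)%N; first exact: leq_subr.
by rewrite kernel_iter_trunc_shift ?leq_subr// subKn.
Qed.
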